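(* Let $G$ be a countable, finitely generated amenable group and let $A$ be a finite set. For every $c\in[0,\log|A|]$ there exists a weakly mixing shift $X\subseteq A^G$ with $h(X)=c$.
   Context: $A^G$ carries the product topology ($A$ discrete), and $G$ acts on it by $[gx](h)=x(g^{-1}h)$. A shift is a closed $G$-invariant subset $X\subseteq A^G$. For finite $K\subset G$, $x_K$ is the restriction of $x$ to $K$ and $X_K=\{x_K : x\in X\}$. A shift $X$ is weakly mixing (in the topological sense) if the diagonal action of $G$ on $X\times X$ is topologically transitive, i.e. for all nonempty open $U,V\subseteq X\times X$ there is $g\in G$ with $gU\cap V\neq\emptyset$. Fix a left-invariant word metric $d$ on $G$, and let $B_r=\{g\in G: d(e,g)\le r\}$. For finite $F\subset G$ let $\partial_rF=\{g\in G: gB_r\cap F\ne\emptyset \text{ and } gB_r\cap(G\setminus F)\neq\emptyset\}$ and $\rho_r(F)=|\partial_rF|/|F|$. A sequence $(F_n)$ of finite subsets of $G$ is Følner if $\lim_n\rho_r(F_n)=0$ for every $r\in\mathbb{N}$. The entropy of a shift $X$ is $h(X)=\lim_{n\to\infty}\frac{1}{|F_n|}\log|X_{F_n}|$ for any Følner sequence $(F_n)$ (the limit exists and does not depend on the sequence).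
   Formalization: The group G is assumed to be countably infinite; for a finite group with |A| ≥ 2 the claim fails, since there are only finitely many shifts and hence only finitely many entropy values. *)

(* Defs.v *)
From HB Require Import structures.
From mathcomp Require Import all_boot all_order all_algebra finmap.
From mathcomp Require Import all_classical all_reals all_analysis.
Import Order.TTheory GRing.Theory Num.Theory.
Import numFieldNormedType.Exports.

Set Implicit Arguments.
Unset Strict Implicit.
Unset Printing Implicit Defensive.

Local Open Scope fset_scope.
Local Open Scope classical_set_scope.
Local Open Scope ring_scope.

Section WordMetric.
Variables (G : groupType) (S : {fset G}).

Definition is_word (w : seq G) : bool :=
  all (fun s => (s \in S) || ((s^-1)%g \in S)) w.

Definition word_eval (w : seq G) : G := (\big[*%g/1%g]_(s <- w) s)%g.

Definition generates : Prop :=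
  forall g : G, exists2 w, is_word w & word_eval w = g.

Definition is_word_length (g : G) (n : nat) : Prop :=
  (exists w, [/\ is_word w, size w = n & word_eval w = g]) /\
  (forall w, is_word w -> word_eval w = g -> (n <= size w)%N).

(* [get] returns a default value when no length exists, which [generates]
   excludes. *)
Definition word_length (g : G) : nat := get (is_word_length g).

Definition word_dist (g h : G) : nat := word_length (g^-1 * h)%g.

Definition word_ball (r : nat) : set G := [set g | (word_dist 1%g g <= r)%N].

(* Contained in F B_r, hence finite when S generates G. *)
Definition boundary (r : nat) (F : {fset G}) : set G :=
  [set g | [set (g * b)%g | b in word_ball r] `&` [set` F] !=set0 /\
           [set (g * b)%g | b in word_ball r] `&` ~` [set` F] !=set0].

Definition boundary_ratio (R : realType) (r : nat) (F : {fset G}) : R :=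
  #|` fset_set (boundary r F)|%:R / #|` F|%:R.

(* Nonemptiness is what makes the ratio meaningful: 0 / 0 = 0 here. *)
Definition folner (R : realType) (F : nat -> {fset G}) : Prop :=
  (forall n, F n != fset0) /\
  (forall r, boundary_ratio R r (F n) @[n --> \oo] --> (0 : R)).

(* Amenability of the group generated by S, in Følner's form. *)
Definition amenable (R : realType) : Prop := exists F, folner R F.

End WordMetric.

Notation config G A := {ptws G -> discrete_topology A}.

Section Shifts.
Variables (G : groupType) (A : finType).
Local Notation config := (config G A).

Definition translate (g : G) (x : config) : config :=
  fun h => x (g^-1 * h)%g.

Definition is_shift (X : set config) : Prop :=
  closed X /\ (forall g x, X x -> X (translate g x)).

Definition restriction (K : {fset G}) (x : config) : {ffun K -> A} :=
  [ffun k => x (val k)].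

Definition patterns (K : {fset G}) (X : set config) : set {ffun K -> A} :=
  restriction K @` X.

End Shifts.

Arguments patterns {G A} K X.

(* For U contained in Y, being open in [subspace Y] is relative openness. *)
Definition topologically_transitive (G : groupType) (T : topologicalType)
    (act : G -> T -> T) (Y : set T) : Prop :=
  forall U V : set T, U `<=` Y -> V `<=` Y ->
    open (U : set (subspace Y)) -> open (V : set (subspace Y)) ->
    U !=set0 -> V !=set0 ->
    exists g, (act g @` U) `&` V !=set0.

Definition diag_translate (G : groupType) (A : finType) (g : G)
    (p : config G A * config G A) : config G A * config G A :=
  (translate g p.1, translate g p.2).

Definition weakly_mixing (G : groupType) (A : finType)
    (X : set (config G A)) : Prop :=
  topologically_transitive (@diag_translate G A) (X `*` X).

(* h(X) = c. Only meaningful for nonempty X: the library sets ln 0 = 0,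
   whereas the empty shift has entropy -oo. *)
Definition has_entropy (R : realType) (G : groupType) (A : finType)
    (S : {fset G}) (X : set (config G A)) (c : R) : Prop :=
  forall F : nat -> {fset G}, folner S R F ->
    ln (#|` fset_set (patterns (F n) X)|%:R) / #|` F n|%:R @[n --> \oo] --> c.

(* Main.v *)
Require Import Defs.
From mathcomp Require Import all_boot all_order all_algebra finmap.
From mathcomp Require Import all_classical all_reals all_analysis.
From mathcomp Require Import zify.
Import Order.TTheory GRing.Theory Num.Theory.
Import numFieldNormedType.Exports.

(* Fix a symbol a0 and let X be the set of configurations that take the value
   a0 somewhere in every translate of every member of a family Fam of finite
   sets.  Replacing symbols by a0 never leaves X, so patterns occurring far
   apart may be glued on an a0 background: a translate of W can only be covered
   by the union of the two supports if W is small, and Fam has finitely many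
   members of each cardinality.  Hence X is mixing.

   Fam is chosen greedily.  Adding a set of cardinality s^2 to the family lowers
   log |X_F| / |F| by at most (2 / s) log |A|, simultaneously for all finite F,
   because F has a subset of density at most 2 / s that meets every translate
   contained in F.  Adding all s^2-subsets of a large finite set makes the
   infimum of log |X_F| / |F| almost 0.  So with large sets of growing
   cardinality one can push this infimum down to exactly c.

   By Shearer's inequality, applied to F covered by translates of K, the limit
   of log |X_F| / |F| along any Følner sequence is at most log |X_K| / |K| for
   each finite K, hence equals the infimum. *)

Local Open Scope classical_set_scope.
Local Open Scope ring_scope.

(** * Counting patterns *)

Section Words.
Context {V : eqType} {A : finType}.
Implicit Types (P Q : set (V -> A)) (s t : seq V).

(** Recursing on the head symbol turns the count into a sum over symbols, the form Shearer's
    induction needs; the test at the end discards words that no member of [P] spells. *)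
Fixpoint words P s : seq (seq A) :=
  if s is v :: s' then
    [seq a :: u | a <- enum A, u <- words (P `&` [set x | x v = a]) s']
  else if `[< P !=set0 >] then [:: [::]] else [::].

Lemma mem_words P s u : u \in words P s <-> exists2 x, P x & map x s = u.
Proof.
elim: s P u => [|v s IHs] P u /=.
  case: ifPn => [/asboolP [x Px]|/asboolPn P0]; last first.
    by split=> // -[x Px _]; case: P0; exists x.
  by rewrite inE; split=> [/eqP->|[y _ <-]]; [exists x|].
split=> [/allpairsPdep[a [w [_ /IHs[x [Px <-] <-] ->]]]|[x Px <-]]; first by exists x.
apply/allpairsPdep; exists (x v), (map x s); split=> //; first by rewrite mem_enum.
by apply/IHs; exists x.
Qed.

Lemma uniq_words P s : uniq (words P s).
Proof.
elim: s P => [|v s IHs] P /=; first by case: ifP.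
apply: allpairs_uniq_dep => //; first exact: enum_uniq.
by move=> [a u] [b w] _ _ /= [-> ->].
Qed.

Definition nwords P s := size (words P s).

Lemma nwords_cons P v s :
  nwords P (v :: s) = (\sum_(a : A) nwords (P `&` [set x | x v = a]) s)%N.
Proof. by rewrite /nwords /= size_allpairs_dep sumnE big_map big_enum. Qed.

Lemma leq_nwords_map P s (r : seq (seq A)) (f : seq A -> seq A) :
  (forall x, P x -> exists2 u, u \in r & f u = map x s) ->
  (nwords P s <= size r)%N.
Proof.
move=> Pf; rewrite -(size_map f); apply: uniq_leq_size (uniq_words P s) _.
by move=> _ /mem_words[x /Pf[u ur <-] <-]; exact: map_f.
Qed.

Lemma leq_nwords P Q s :
  (forall x, P x -> exists2 y, Q y & {in s, x =1 y}) ->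
  (nwords P s <= nwords Q s)%N.
Proof.
move=> PQ; apply: (@leq_nwords_map _ _ _ id) => x /PQ[y Qy xy].
exists (map y s); first by apply/mem_words; exists y.
by apply/esym/eq_in_map.
Qed.

Lemma nwords_sub (a0 : A) P s t : {subset s <= t} -> (nwords P s <= nwords P t)%N.
Proof.
move=> st.
apply: (@leq_nwords_map _ _ _ (fun u => [seq nth a0 u (index v t) | v <- s])).
move=> x Px; exists (map x t); first by apply/mem_words; exists x.
by apply/eq_in_map => v /st vt; rewrite (nth_map v) ?index_mem// nth_index.
Qed.

Lemma nwords_gt0 P s : (0 < nwords P s)%N <-> P !=set0.
Proof.
split=> [|[x Px]]; last first.
  have : map x s \in words P s by apply/mem_words; exists x.
  by rewrite /nwords; case: words.
rewrite /nwords; case w: words => [//|u r] _.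
have /mem_words[x Px _] : u \in words P s by rewrite w mem_head.
by exists x.
Qed.

Lemma nwords_le_expn P s : (nwords P s <= #|A| ^ size s)%N.
Proof.
elim: s P => [|v s IHs] P; first by rewrite /nwords /=; case: ifP.
rewrite nwords_cons expnS -sum_nat_const; exact: leq_sum.
Qed.

Lemma expn_le_nwords_setT (a0 : A) s : uniq s -> (#|A| ^ size s <= nwords setT s)%N.
Proof.
move=> us; rewrite -card_tuple cardE -(size_map val).
apply: uniq_leq_size; first by rewrite map_inj_uniq ?enum_uniq//; exact: val_inj.
move=> _ /mapP[t _ ->]; apply/mem_words; exists (fun v => nth a0 t (index v s)) => //.
case: s us t => [|v0 s] us t; first by rewrite tuple0.
apply: (@eq_from_nth _ a0) => [|i]; rewrite size_map ?size_tuple// => lti.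
by rewrite (nth_map v0)// index_uniq.
Qed.

End Words.

(** * Shearer's inequality *)

(** Hölder's inequality with equal exponents, in powers to avoid roots: normalise each [y i] to
    total 1, apply AM-GM at every [t], and sum. [C] carries factors independent of [t]. *)
Lemma holder_sum (R : realType) (I T : finType) (J : {pred I})
    (C : R) (y : I -> T -> R) (z : T -> R) :
  (0 < #|J|)%N -> 0 <= C -> (forall i t, 0 <= y i t) -> (forall t, 0 <= z t) ->
  (forall t, z t ^+ #|J| <= C * \prod_(i in J) y i t) ->
  (\sum_t z t) ^+ #|J| <= C * \prod_(i in J) \sum_t y i t.
Proof.
move=> k0 C0 y0 z0 zy; set k := #|J| in k0 zy *.
pose s i := \sum_t y i t; have s0 i : 0 <= s i by exact: sumr_ge0.
have M0 : 0 <= C * \prod_(i in J) s i by rewrite mulr_ge0// prodr_ge0.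
have [M_eq0|M_neq0] := eqVneq (C * \prod_(i in J) s i) 0.
  rewrite big1 ?expr0n ?lt0n_neq0 ?gtn_eqF// => t _.
  have : z t ^+ k == 0.
    rewrite eq_le exprn_ge0// andbT -M_eq0; apply: le_trans (zy t) _.
    rewrite ler_wpM2l// ler_prod// => i _; rewrite y0/=.
    by rewrite /s (bigD1 t)//= lerDl sumr_ge0.
  by rewrite expf_eq0 k0 => /eqP.
(* The k-th root of the right-hand side. *)
pose w := expR (ln (C * \prod_(i in J) s i) / k%:R).
have wk : w ^+ k = C * \prod_(i in J) s i.
  rewrite /w -expRM_natl mulrC divfK ?pnatr_eq0 -?lt0n// lnK// posrE lt_neqAle eq_sym M_neq0//.
rewrite -wk lerXn2r ?nnegrE ?sumr_ge0 ?expR_ge0//.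
have [Cn0 sn0] : C != 0 /\ forall i, i \in J -> s i != 0.
  move: M_neq0; rewrite mulf_eq0 negb_or => /andP[-> /prodf_neq0 h]; by split.
have zt t : z t <= w * ((\sum_(i in J) y i t / s i) / k%:R).
  rewrite -(@ler_pXn2r _ k) ?nnegrE//; last first.
    by rewrite mulr_ge0 ?expR_ge0// divr_ge0// sumr_ge0// => i _; rewrite divr_ge0.
  apply: le_trans (zy t) _; rewrite exprMn wk -mulrA ler_wpM2l//.
  have := (leif_AGM (A := J) (E := fun i => y i t / s i)) (fun i _ => divr_ge0 (y0 i t) (s0 i)).
  move=> -[h _]; apply: le_trans _ (ler_wpM2l _ h); last by rewrite prodr_ge0.
  rewrite -big_split/= le_eqVlt; apply/orP; left; apply/eqP/eq_bigr => i iJ.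
  by rewrite mulrCA divff ?sn0// mulr1.
apply: (le_trans (ler_sum _ (fun t _ => zt t))).
rewrite -mulr_sumr -mulr_suml exchange_big/= (eq_bigr (fun=> 1)); last first.
  by move=> i iJ; rewrite -mulr_suml divff// sn0.
by rewrite sumr_const divff ?mulr1// pnatr_eq0 -lt0n.
Qed.

Section Shearer.
Context (R : realType) {V : eqType} {A I : finType}.

(** Induction on [s]. Splitting by the symbol at the head [v] turns the counts of the [k] sets
    containing [v] into sums, which Hölder's inequality combines; for the other sets, dropping the
    condition at [v] only increases the count. *)
Lemma shearer (P : set (V -> A)) (s : seq V) (C : I -> {pred V}) (k : nat) :
  (0 < k)%N -> (forall v, v \in s -> #|[pred i | v \in C i]| = k) ->
  (nwords P s ^ k <= \prod_i nwords P [seq v <- s | v \in C i])%N.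
Proof.
move=> k0; rewrite -(ler_nat R) natrX natr_prod.
elim: s P => [|v s IHs] P sk.
  rewrite /nwords/=; case: ifP => _; rewrite ?expr1n.
    by rewrite big1.
  by rewrite expr0n gtn_eqF// prodr_ge0.
have vk := sk v (mem_head _ _).
have {}IHs Q := IHs Q (fun u us => sk u (@mem_behead _ (v :: s) u us)).
rewrite [leRHS](bigID [pred i | v \in C i])/= mulrC.
rewrite nwords_cons natr_sum.
under [X in _ * X]eq_bigr => i ivC.
  rewrite ivC nwords_cons natr_sum.
  over.
rewrite -vk; apply: holder_sum; rewrite ?vk//; first exact: prodr_ge0.
move=> a; apply: le_trans (IHs _) _.
rewrite [leLHS](bigID [pred i | v \in C i])/= mulrC.
apply: ler_wpM2r; first exact: prodr_ge0.
apply: ler_prod => i ivC; rewrite ler0n (negbTE ivC) ler_nat.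
by apply: leq_nwords => x [Px _]; exists x.
Qed.

End Shearer.

(** * Hitting shifts *)

(* While some point lies in at least s of the remaining edges, pick it; then
   pick one point from each edge that is left. *)
Lemma greedy_hitting (J : Type) (V : choiceType) (F : {fset V})
    (e : J -> {fset V}) (r : seq J) (s m : nat) :
  (0 < s)%N -> (0 < m)%N ->
  (forall j, (m <= #|` e j|)%N) -> all (fun j => e j `<=` F)%fset r ->
  exists2 D : seq V, (size D * (s * m) <= size r * m + s * s * #|` F|)%N &
    all (fun j => has (fun v => v \in e j) D) r.
Proof.
move=> s0 m0 em; have [n] := ubnP (size r); elim: n r => // n IHn r rn rF.
have [/hasP[v vF vs]|/hasPn light] :=
    boolP (has (fun v => s <= count (fun j => v \in e j) r)%N (enum_fset F)).
  pose r' := [seq j <- r | v \notin e j].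
  have rr' : (size r = count (fun j => v \in e j) r + size r')%N.
    by rewrite size_filter -(count_predC (fun j => v \in e j) r).
  have [||D DF Dr'] := IHn r'.
  - by rewrite -ltnS (leq_trans _ rn)// ltnS rr' -add1n leq_add2r (leq_trans s0).
  - by rewrite all_filter; apply: sub_all rF => j /= ->; rewrite implybT.
  exists (v :: D); first by rewrite /= rr' mulSn mulnDl -addnA leq_add// leq_mul2r vs orbT.
  move: Dr'; rewrite all_filter; apply: sub_all => j /=.
  by case: (v \in e j).
(* Double counting: each remaining edge has at least [m] points, and each point of [F] lies in fewer
   than [s] of them. *)
have rmF : (size r * m <= s * #|` F|)%N.
  apply: (@leq_trans (\sum_(j <- r) #|` e j|)%N).
    rewrite -sum1_size big_distrl/= leq_sum// => j _.
    by rewrite mul1n.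
  have -> : (\sum_(j <- r) #|` e j| = \sum_(v <- enum_fset F) count (fun j => v \in e j) r)%N.
    rewrite (eq_bigr (fun v => \sum_(j <- r) (v \in e j : nat))%N); last first.
      by move=> v _; rewrite -sum1_count big_mkcond.
    rewrite exchange_big/=; elim: r rF {rn light} => [|j r IHr]/=; first by rewrite !big_nil.
    move=> /andP[jF /IHr rF]; rewrite !big_cons rF; congr addn.
    transitivity (count (fun v => v \in e j) (enum_fset F)); last by rewrite -sum1_count big_mkcond.
    rewrite -size_filter; apply/perm_size/uniq_perm; rewrite ?filter_uniq ?fset_uniq// => v.
    rewrite mem_filter andb_idr// => /(fsubsetP jF) //.
  rewrite mulnC -sum1_size big_distrl/= big_seq [leqRHS]big_seq.
  by apply: leq_sum => v /light; rewrite mul1n; lia.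
exists (flatten [seq take 1 (enum_fset (e j)) | j <- r]).
  have : (size (flatten [seq take 1 (enum_fset (e j)) | j <- r]) <= size r)%N.
    elim: r {rn rF light rmF} => //= j r IHr; rewrite size_cat -[leqRHS]add1n leq_add//.
    by rewrite size_take; case: ltnP => //.
  move=> /leq_mul - /(_ (s * m) _ (leqnn _)) => /leq_trans; apply.
  by rewrite mulnCA -mulnA (leq_trans _ (leq_addl _ _))// leq_mul2l rmF orbT.
elim: r {rn rF light rmF} => //= j r IHr; apply/andP; split.
  rewrite has_cat; apply/orP; left; move: (leq_trans m0 (em j)).
  case ej: (enum_fset (e j)) => [|v l]//= _.
  by rewrite take0/= orbF; have : v \in enum_fset (e j) by rewrite ej mem_head.
by apply: sub_all IHr => i; rewrite has_cat orbC => ->.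
Qed.

Section HittingShift.
Context {G : groupType} {A : finType} (a0 : A).
Implicit Types (W F B : {fset G}) (E L : seq {fset G}) (Fam : set {fset G}).

Definition hitting_shift Fam : set (G -> A) :=
  [set x | forall W, Fam W -> forall h, exists2 w, w \in W & x (h * w)%g = a0].

Definition zero_outside (p : pred G) (x : G -> A) : G -> A :=
  fun v => if p v then x v else a0.

(** Writing [a0] destroys no occurrence of [a0], and a set all of whose translates leave [p] is hit
    for free. *)
Lemma zero_outside_hitting Fam Fam' p x : hitting_shift Fam x ->
  (forall W, Fam' W -> Fam W \/
     forall h, exists2 w, w \in W & ~~ p (h * w)%g) ->
  hitting_shift Fam' (zero_outside p x).
Proof.
move=> Xx F' W /F'[FW|pW] h.
  by have [w wW xw] := Xx _ FW h; exists w => //; rewrite /zero_outside xw if_same.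
by have [w wW /negbTE pw] := pW h; exists w => //; rewrite /zero_outside pw.
Qed.

(** Overwriting by [a0] on a hitting set [D] and outside [F] lands in the smaller shift; only the
    symbols on [D] are lost, and they allow at most [#|A| ^ size D] choices. *)
Lemma nwords_hitting_cons E W F s : (0 < s)%N -> (s * s <= #|` W|)%N ->
  exists2 d, (d * s <= 2 * #|` F|)%N &
    (nwords (hitting_shift [set` E]) (enum_fset F) <=
     nwords (hitting_shift [set` W :: E]) (enum_fset F) * #|A| ^ d)%N.
Proof.
move=> s0 sW; have ss0 : (0 < s * s)%N by rewrite muln_gt0 s0.
pose e h := [fset (h * w)%g | w in W]%fset.
have [w0 w0W] : exists w0, w0 \in W.
  by apply/fset0Pn; rewrite -cardfs_gt0 (leq_trans ss0).
pose r := [seq h <- [seq (f * w0^-1)%g | f <- enum_fset F] | (e h `<=` F)%fset].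
have rF : (size r <= #|` F|)%N.
  by rewrite (leq_trans (size_subseq (filter_subseq _ _)))// size_map.
have em h : (s * s <= #|` e h|)%N.
  by rewrite card_imfset//; exact: mulgI.
(* With edges of size [s * s] the two terms of the greedy bound balance, so [D] has density at most
   2 / s in [F]. *)
have [D DF /allP Dr] := @greedy_hitting _ _ F e r s (s * s) s0 ss0 em (filter_all _ _).
exists (size D).
  rewrite -(leq_pmul2r ss0); have := leq_mul rF (leqnn (s * s)).
  by move: DF; move: (size D) (size r) (#|` F|) => d k n; lia.
pose f (q : seq A * seq A) := [seq if v \in D then nth a0 q.2 (index v D)
  else nth a0 q.1 (index v (enum_fset F)) | v <- enum_fset F].
pose X' := hitting_shift [set` W :: E].
rewrite -/X'; apply: (@leq_trans (size [seq (u, v) | u <- words X' (enum_fset F),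
    v <- words setT D])); last first.
  by rewrite size_allpairs; apply: leq_mul => //; exact: nwords_le_expn.
rewrite /nwords -(size_map f); apply: uniq_leq_size (uniq_words _ _) _.
move=> _ /mem_words[x Xx <-].
pose p := [pred v | (v \in F) && (v \notin D)].
apply/mapP; exists (map (zero_outside p x) (enum_fset F), map x D).
  apply: allpairs_f; apply/mem_words; last by exists x.
  exists (zero_outside p x) => //; apply: zero_outside_hitting Xx _ => U /=.
  rewrite inE => /orP[/eqP->|UE]; [right|by left] => h.
  have [/fsubsetP hF|/fsubsetPn] := boolP (e h `<=` F)%fset; last first.
    move=> [_ /imfsetP[w /= wW ->] hwF]; exists w => //.
    by rewrite (negbTE hwF).
  have /Dr /hasP[v vD /imfsetP[w /= wW vhw]] : h \in r.
    rewrite mem_filter; apply/andP; split; first exact/fsubsetP.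
    apply/mapP; exists (h * w0)%g; last by rewrite mulgK.
    by apply: hF; apply/imfsetP; exists w0.
  by exists w => //; rewrite -vhw vD andbF.
apply/eq_in_map => v vF /=; case: ifPn => vD.
  by rewrite (nth_map v) ?index_mem// nth_index.
by rewrite (nth_map v) ?index_mem// nth_index// /zero_outside /= vD; case: ifP => //; rewrite vF.
Qed.

(** When every m-subset of [B] must be hit, a pattern on [B] has at most [m] symbols other than
    [a0]; for fixed [m] the count is then polynomial in the size of [B]. *)
Lemma nwords_hitting_small E B m : (0 < #|` B|)%N ->
  (forall W, (W `<=` B)%fset -> #|` W| = m -> W \in E) ->
  (nwords (hitting_shift [set` E]) (enum_fset B) <= (#|` B| * #|A|) ^ m)%N.
Proof.
move=> B0 BE; have [b0 b0B] : exists b, b \in B.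
  by apply/fset0Pn; rewrite -cardfs_gt0.
(* A pattern on B with at most m symbols other than a0 is determined by a list of
   m pairs (position, symbol) covering its support. *)
pose T := {: m.-tuple ('I_#|` B| * A)}.
have cT : ((#|` B| * #|A|) ^ m = #|T|)%N by rewrite card_tuple card_prod card_ord.
pose f (q : T) := [seq nth a0 (unzip2 q) (index v
  [seq nth b0 (enum_fset B) (val i) | i <- unzip1 q]) | v <- enum_fset B].
rewrite cT cardE /nwords -(size_map f); apply: uniq_leq_size (uniq_words _ _) _.
move=> _ /mem_words[x Xx <-].
pose S := [seq v <- enum_fset B | x v != a0].
have Sm : (size S <= m)%N.
  rewrite leqNgt; apply/negP => mS; pose W := [fset v in take m S]%fset.
  have /Xx/(_ 1%g)[w] : W \in E.
    apply: BE.
      apply/fsubsetP => v; rewrite inE => /mem_take.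
      by rewrite mem_filter => /andP[].
    rewrite card_fseq undup_id ?take_uniq ?filter_uniq ?fset_uniq//.
    by rewrite size_take mS.
  by rewrite inE mul1g => /mem_take; rewrite mem_filter => /andP[/negP + _] /eqP.
(* Padding to length [m] is harmless: the extra pairs record the true symbol at [b0]. *)
pose S' := S ++ nseq (m - size S) b0.
have S'B v : v \in S' -> v \in B.
  rewrite mem_cat mem_filter => /orP[/andP[]//|/nseqP[->] //].
have lt v : v \in B -> (index v (enum_fset B) < #|` B|)%N by rewrite -index_mem.
pose o v : 'I_#|` B| := insubd (Ordinal B0) (index v (enum_fset B)).
have ov v : v \in B -> val (o v) = index v (enum_fset B).
  by move=> vB; rewrite val_insubd lt.
have sz : size [seq (o v, x v) | v <- S'] == m.
  by rewrite size_map size_cat size_nseq subnKC.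
apply/mapP; exists (Tuple sz); first by rewrite mem_enum.
apply/eq_in_map => v vB.
have -> : unzip2 (Tuple sz) = map x S' by rewrite /unzip2 /= -map_comp; apply: eq_map.
have -> : [seq nth b0 (enum_fset B) (val i) | i <- unzip1 (Tuple sz)] = S'.
  rewrite /unzip1 /= -!map_comp -[RHS]map_id; apply/eq_in_map => u /S'B uB /=.
  by rewrite ov// nth_index.
have [vS'|vS'] := boolP (v \in S'); first by rewrite (nth_map v) ?index_mem// nth_index.
rewrite nth_default; last by rewrite size_map leqNgt index_mem.
by apply/eqP; apply: contraNT vS' => xv; rewrite mem_cat mem_filter xv vB.
Qed.

End HittingShift.

(** * The greedy family *)

Lemma expR_gt_polynomial (R : realType) (a m : nat) (eps : R) : 0 < eps ->
  exists n0, forall n, (n0 < n)%N -> ((n * a) ^ m)%:R < expR (eps * n%:R).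
Proof.
(* With m + 1 equal shares, the bound q n <= exp (q n) yields one more power of [n] than the
   polynomial has. *)
move=> eps0; have [q q0 ->] : exists2 q : R, 0 < q & eps = m.+1%:R * q.
  by exists (eps / m.+1%:R); rewrite ?divr_gt0// mulrC divfK ?pnatr_eq0.
exists (Num.bound (a%:R ^+ m / q ^+ m.+1)) => n n0n.
have n0 : (0 < n)%N by apply: leq_ltn_trans n0n.
rewrite -mulrA expRM_natl; apply: (@lt_le_trans _ _ ((q * n%:R) ^+ m.+1)); last first.
  rewrite lerXn2r ?nnegrE ?expR_ge0 ?mulr_ge0 ?ler0n ?ltW//.
  by apply: lt_le_trans (expR_ge1Dx _); rewrite ltrDr.
rewrite natrX natrM !exprMn [n%:R ^+ m.+1]exprSr [ltRHS]mulrCA ltr_pM2l ?exprn_gt0 ?ltr0n//.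
rewrite mulrC -ltr_pdivrMr ?exprn_gt0//.
apply: (@lt_trans _ _ _ _ _ (archi_boundP _)); last by rewrite ltr_nat.
by rewrite divr_ge0 ?exprn_ge0// ltW.
Qed.

Section Construction.
Context {R : realType} {G : groupType} {A : finType} (a0 : A).
Context (G_infinite : infinite_set [set: G]).
Implicit Types (W F K : {fset G}) (E L : seq {fset G}) (Fam : set {fset G}).

(** The exponential form also encodes nonemptiness: at the empty [F] it asks for at least one
    word. *)
Definition entropy_ge (c : R) (X : set (G -> A)) :=
  forall F, expR (c * #|` F|%:R) <= (nwords X (enum_fset F))%:R.

(** Subsets of size [s * s] of a large [B] are added one by one while the rate stays at least [c].
    Either all get in, and the count on [B] is small, or the next would push some [K] below [c]; as
    one set costs at most [eps], that [K] is already below [c + eps]. *)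
Lemma refine_hitting (c eps : R) (k : nat) E :
  0 <= c -> 0 < eps -> entropy_ge c (hitting_shift a0 [set` E]) ->
  exists L, [/\ {in L, forall W, (k <= #|` W|)%N},
    entropy_ge c (hitting_shift a0 [set` L ++ E]) &
    exists K, (nwords (hitting_shift a0 [set` L ++ E]) (enum_fset K))%:R
              < expR ((c + eps) * #|` K|%:R)].
Proof.
move=> c0 eps0 cE.
have A0 : (0 < #|A|)%N by apply/card_gt0P; exists a0.
have lnA0 : 0 <= ln (#|A|%:R : R) by rewrite ln_ge0// ler1n.
(* Large enough for the cost 2 ln |A| / s of one set to be at most [eps], and for [s * s] to be at
   least [k]. *)
pose s := (k + Num.bound (2 * ln (#|A|%:R : R) / eps)).+1.
have s_eps : 2 * ln (#|A|%:R : R) <= eps * s%:R.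
  rewrite [leRHS]mulrC -ler_pdivrMr//.
  apply: le_trans (ltW (archi_boundP _)) _; first by rewrite divr_ge0 ?mulr_ge0// ltW.
  by rewrite ler_nat /s ltnW// ltnS leq_addl.
have cost W F L : #|` W| = (s * s)%N ->
    (nwords (hitting_shift a0 [set` L]) (enum_fset F))%:R <=
    (nwords (hitting_shift a0 [set` W :: L]) (enum_fset F))%:R
      * expR (eps * #|` F|%:R).
  move=> Ws; have [//||d ds] := @nwords_hitting_cons _ _ a0 L W F s; first by rewrite Ws.
  rewrite -(ler_nat R) => /le_trans; apply.
  rewrite natrM ler_wpM2l// natrX -[X in X ^+ _]lnK ?posrE ?ltr0n//.
  rewrite -expRM_natl ler_expR.
  rewrite -(@ler_pM2r _ s%:R)// mulrAC.
  apply: (@le_trans _ _ (2 * #|` F|%:R * ln (#|A|%:R : R))).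
    by rewrite ler_wpM2r// -!natrM ler_nat.
  by rewrite mulrAC [leRHS]mulrAC ler_wpM2r.
have [n0 n0P] := expR_gt_polynomial R #|A| (s * s) eps eps0.
have [B _ n0B] := infinite_set_fset n0.+1 G_infinite.
have greedy (r : seq {fset G}) : {in r, forall W, #|` W| = (s * s)%N} ->
    exists L, [/\ {in L, forall W, #|` W| = (s * s)%N},
      entropy_ge c (hitting_shift a0 [set` L ++ E]) &
      {subset r <= L} \/ exists K,
        (nwords (hitting_shift a0 [set` L ++ E]) (enum_fset K))%:R
          < expR ((c + eps) * #|` K|%:R)].
  elim: r => [_|W r IHr rs]; first by exists [::]; split=> //; left.
  have [|L [Ls cL rL]] := IHr; first by move=> U Ur; apply: rs; rewrite inE Ur orbT.
  have [{}rL|] := rL; last by exists L; split=> //; right.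
  have Ws : #|` W| = (s * s)%N by apply: rs; rewrite mem_head.
  have [cWL|/existsNP[K /negP]] :=
    pselect (entropy_ge c (hitting_shift a0 [set` (W :: L) ++ E])).
    exists (W :: L); split=> //.
      by move=> U; rewrite inE => /orP[/eqP->//|/Ls].
    by left=> U; rewrite !inE => /orP[->//|/rL ->]; rewrite orbT.
  rewrite -ltNge => WK; exists L; split=> //; right; exists K.
  apply: le_lt_trans (cost W K (L ++ E) Ws) _.
  by rewrite mulrDl expRD ltr_pM2r ?expR_gt0.
have [r rP] : exists r : seq {fset G},
    forall W, W \in r <-> (W `<=` B)%fset /\ #|` W| = (s * s)%N.
  exists [seq W <- enum_fset (fpowerset B) | #|` W| == (s * s)%N] => W.
  rewrite mem_filter andbC -[W \in enum_fset _]/(W \in fpowerset B) fpowersetE.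
  by split=> [/andP[-> /eqP]|[-> ->]]; rewrite ?eqxx.
have [|L [Ls cL rL]] := greedy r; first by move=> W /rP[].
exists L; split=> //.
  move=> W /Ls ->; rewrite /s; nia.
case: rL => [rL|//]; exists B.
apply: (@le_lt_trans _ _ ((#|` B| * #|A|) ^ (s * s))%:R).
  rewrite ler_nat nwords_hitting_small//; first by rewrite (leq_trans _ n0B).
  by move=> W WB Ws; rewrite mem_cat rL//; apply/rP.
apply: (lt_le_trans (n0P _ n0B)).
by rewrite ler_expR ler_wpM2r// lerDr.
Qed.

(** The union of successive refinements: step n adds sets with more than n elements and brings the
    rate at some [K] below c + 1 / (n + 1). *)
Lemma exists_hitting_family (c : R) : 0 <= c -> c <= ln #|A|%:R ->
  exists Fam : set {fset G},
  [/\ forall n, exists E, forall W, Fam W -> (#|` W| <= n)%N -> W \in E,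
      entropy_ge c (hitting_shift a0 Fam) &
      forall eps : R, 0 < eps -> exists K,
        (nwords (hitting_shift a0 Fam) (enum_fset K))%:R
          < expR ((c + eps) * #|` K|%:R)].
Proof.
move=> c0 cA.
(* [p] holds the step number and the family so far; the premise on [p.2] makes the relation total,
   so choice applies. *)
pose refines (p : nat * seq {fset G}) L :=
  entropy_ge c (hitting_shift a0 [set` p.2]) ->
  [/\ {in L, forall W, (p.1 < #|` W|)%N},
    entropy_ge c (hitting_shift a0 [set` L ++ p.2]) &
    exists K, (nwords (hitting_shift a0 [set` L ++ p.2]) (enum_fset K))%:R
              < expR ((c + p.1.+1%:R^-1) * #|` K|%:R)].
have refinable p : exists L, refines p L.
  case: p => k E.
  have [cE|] := pselect (entropy_ge c (hitting_shift a0 [set` E])); last by exists [::].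
  have [|L LP] := @refine_hitting c k.+1%:R^-1 k.+1 E c0 _ cE; first by rewrite invr_gt0.
  by exists L.
have [f fP] := choice refinable.
pose Es := fix Es n := if n is k.+1 then f (k, Es k) ++ Es k else [::].
have A0 : (0 < #|A|)%N by apply/card_gt0P; exists a0.
have cEs n : entropy_ge c (hitting_shift a0 [set` Es n]).
  elim: n => [F|n /(fP (n, _))[]//].
  apply: (@le_trans _ _ (#|A| ^ #|` F|)%:R).
    by rewrite natrX -[X in X ^+ _]lnK ?posrE ?ltr0n// -expRM_natl ler_expR mulrC ler_wpM2l.
  rewrite ler_nat (leq_trans (expn_le_nwords_setT a0 _ (fset_uniq F)))//.
  by apply: leq_nwords => x _; exists x.
have Es_mono m n : (m <= n)%N -> {subset Es m <= Es n}.
  move=> /subnK <-; elim: (n - m)%N => // d IHd W /IHd; rewrite addSn /= mem_cat => ->.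
  by rewrite orbT.
have Es_old n k W : W \in Es n -> (#|` W| <= k)%N -> W \in Es k.
  move=> + Wk; elim: n => // n IHn; rewrite [Es _]/= mem_cat => /orP[Wf|//].
  have [/(_ W Wf)/= nW _ _] := fP (n, Es n) (cEs n).
  by apply: (Es_mono n.+1); [exact: leq_trans Wk|rewrite /= mem_cat Wf].
exists [set W | exists n, W \in Es n]; split.
- by move=> n; exists (Es n) => W [m /Es_old]; apply.
- move=> F; apply: le_trans (cEs #|` F| F) _; rewrite ler_nat; apply: leq_nwords => x Xx.
  exists (zero_outside a0 (mem F) x); last by move=> v; rewrite /zero_outside /= => ->.
  apply: zero_outside_hitting Xx _ => W [n Wn].
  have [WF|WF] := leqP #|` W| #|` F|; [by left; exact: Es_old Wn WF|right=> h].
  have : ~~ ([fset (h * w)%g | w in W] `<=` F)%fset.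
    by apply/negP => /fsubset_leq_card; rewrite card_imfset; [rewrite leqNgt WF|exact: mulgI].
  by move=> /fsubsetPn[_ /imfsetP[w /= wW ->] hwF]; exists w.
move=> eps eps0; pose k := Num.bound eps^-1.
have [_ _ [K KP]] := fP (k, Es k) (cEs k).
exists K; apply: (@le_lt_trans _ _ (nwords (hitting_shift a0 [set` Es k.+1]) (enum_fset K))%:R).
  rewrite ler_nat; apply: leq_nwords => x Xx; exists x => // W WE.
  by apply: Xx; exists k.+1.
apply: lt_le_trans KP _; rewrite ler_expR ler_wpM2r// lerD2l /=.
rewrite -[leRHS]invrK lef_pV2 ?posrE ?invr_gt0//.
apply: le_trans (ltW (archi_boundP _)) _; first by rewrite invr_ge0 ltW.
by rewrite ler_nat.
Qed.

End Construction.

(** * Mixing *)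

Section Topology.
Context {G : groupType} {A : finType}.
Implicit Types (x y : config G A) (K : seq G).

Definition cylinder K x : set (config G A) :=
  [set y : config G A | {in K, (y : G -> A) =1 x}].

Lemma nbhs_cylinder K x : nbhs x (cylinder K x).
Proof.
elim: K => [|k K IHK]; first by apply: filterS filterT => y _ k.
have kx : nbhs x [set y : config G A | y k = x k].
  exact: (@proj_continuous G (fun=> discrete_topology A) k x _ (discrete_set1 _)).
apply: filterS (filterI kx IHK) => y [/= yk yK] j.
by rewrite inE => /orP[/eqP->//|/yK].
Qed.

(** The product topology is the supremum of those induced by the coordinates, so convergence of the
    filter of cylinders is checked one coordinate at a time. *)
Lemma cylinder_nbhs x (U : set (config G A)) : nbhs x U -> exists K, cylinder K x `<=` U.
Proof.
pose F := filter_from setT (cylinder^~ x).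
have FF : Filter F.
  apply: filter_from_filter; first by exists [::].
  move=> K L _ _; exists (K ++ L) => // y yKL.
  by split=> k kK; apply: yKL; rewrite mem_cat kK ?orbT.
suff Fx : F --> x by move=> /Fx[K _ KU]; exists K.
apply/cvg_sup => k V [B [[C oC CB] Bx] BV].
exists [:: k] => // y yk; apply: BV; rewrite -CB /= /proj.
by move: Bx; rewrite -CB /= /proj (yk k) ?mem_head.
Qed.

Context (a0 : A) (Fam : set {fset G}).
Let X : set (config G A) := hitting_shift a0 Fam.

(** Closed because each instance of the condition reads finitely many coordinates, which a point of
    the closure shares with a member. *)
Lemma hitting_is_shift : is_shift X.
Proof.
split=> [x Xx W FW h|g x Xx W FW h]; last first.
  have [w wW xw] := Xx W FW (g^-1 * h)%g; exists w => //.
  by rewrite /translate mulgA.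
have [y [Xy xy]] := Xx _ (nbhs_cylinder [seq (h * w)%g | w <- enum_fset W] x).
have [w wW yw] := Xy W FW h; exists w => //.
by rewrite -yw xy// map_f.
Qed.

Lemma separating_element (D : seq G) : infinite_set [set: G] ->
  exists g, forall p q r s, p \in D -> q \in D -> r \in D -> s \in D ->
    g != (p * q^-1 * (r * s^-1))%g.
Proof.
move=> Ginf; pose D2 := [seq (p * q^-1)%g | p <- D, q <- D].
have [g gD] : exists g, g \notin [seq (p * q)%g | p <- D2, q <- D2].
  apply: contrapT => /forallNP gD; apply: Ginf.
  apply: sub_finite_set (finite_seq [seq (p * q)%g | p <- D2, q <- D2]) => g _ /=.
  by have /negP := gD g; rewrite negbK.
exists g => p q r s pD qD rD sD; apply: contraNneq gD => ->.
by apply: allpairs_f; exact: allpairs_f.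
Qed.

Lemma hitting_weakly_mixing : infinite_set [set: G] ->
  (forall n, exists E : seq {fset G}, forall W, Fam W -> (#|` W| <= n)%N -> W \in E) ->
  weakly_mixing X.
Proof.
move=> Ginf Fam_small U V UX VX oU oV [u Uu] [v Vv].
(* A relatively open set contains, around each point, the trace of a product of two cylinders; one
   list of coordinates serves both factors. *)
have XX_cyl (O : set (config G A * config G A)) z : O `<=` X `*` X ->
    open (O : set (subspace (X `*` X))) -> O z ->
    exists K, forall y : config G A * config G A, X y.1 -> X y.2 ->
      cylinder K z.1 y.1 -> cylinder K z.2 y.2 -> O y.
  move=> OX oO Oz; have Xz := OX _ Oz.
  have : within (X `*` X) (nbhs z) O.
    rewrite nbhs_subspace_in//.
    by apply: (@open_nbhs_nbhs _ (z : subspace (X `*` X))); split.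
  rewrite /within/= => -[[P Q] [/= Pz Qz] PQO].
  have [K KP] := cylinder_nbhs _ _ Pz; have [L LQ] := cylinder_nbhs _ _ Qz.
  exists (K ++ L) => y X1 X2 y1 y2; apply: (PQO y) => //; split.
    by apply: KP => k kK; apply: y1; rewrite mem_cat kK.
  by apply: LQ => k kK; apply: y2; rewrite mem_cat kK orbT.
have [K KU] := XX_cyl U u UX oU Uu; have [L LV] := XX_cyl V v VX oV Vv.
(* A set with a translate covered by the two supports has at most [size K + size L] elements, so
   only the members of [E] need care. *)
have [E EP] := Fam_small (size K + size L)%N.
pose D := 1%g :: K ++ L ++ flatten [seq enum_fset W | W <- E].
have KD k : k \in K -> k \in D by move=> kK; rewrite inE mem_cat kK orbT.
have LD k : k \in L -> k \in D by move=> kL; rewrite inE !mem_cat kL !orbT.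
have WD W w : W \in E -> w \in W -> w \in D.
  move=> WE wW; rewrite /D -cat1s !mem_cat.
  suff -> : w \in flatten [seq enum_fset W | W <- E] by rewrite !orbT.
  by apply/flattenP; exists (enum_fset W) => //; exact: map_f.
have D1 : 1%g \in D by rewrite mem_head.
(* A translate of W that meets both supports of the glued configuration would
   express g as a product of two quotients of elements of D. *)
have [g gD] := separating_element D Ginf.
pose glue (x y : config G A) : config G A := fun h => if h \in K then x h
  else if (g * h)%g \in L then y (g * h)%g else a0.
have Xglue x y : X x -> X y -> X (glue x y).
  move=> Xx Xy W FW h.
  have [/allP hW|/allPn[w wW]] :=
    boolP (all [pred w | ((h * w)%g \in K) || ((g * (h * w))%g \in L)] (enum_fset W)); last first.
    rewrite /= negb_or => /andP[/negbTE hK /negbTE hL].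
    by exists w => //; rewrite /glue hK hL.
  have WE : W \in E.
    apply: EP => //; rewrite -(size_map (fun k => (g^-1 * k)%g) L) -size_cat.
    rewrite -(size_map (fun w => (h * w)%g) (enum_fset W)); apply: uniq_leq_size.
      by rewrite map_inj_uniq ?fset_uniq//; exact: mulgI.
    move=> _ /mapP[w /hW /= /orP[wK|wL] ->]; rewrite mem_cat ?wK//.
    by apply/orP; right; apply/mapP; exists (g * (h * w))%g; rewrite ?mulKg.
  (* By the choice of [g], a translate meeting [K] misses the support carrying [y], so the [a0] of
     [x] survives; a translate missing [K] is hit thanks to the [a0] of [y]. *)
  have [/hasP[w wW whK]|/hasPn hK] := boolP (has (fun w => (h * w)%g \in K) (enum_fset W)).
    have [w' w'W xw'] := Xx W FW h; exists w' => //; rewrite /glue.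
    have /= := hW _ w'W; case: ifP => // _ /= gL.
    have := gD (g * (h * w'))%g w' w (h * w)%g
      (LD _ gL) (WD _ _ WE w'W) (WD _ _ WE wW) (KD _ whK).
    by rewrite invgM !mulgA !mulgK eqxx.
  have [w wW xw] := Xy W FW (g * h)%g; exists w => //; rewrite /glue.
  by rewrite (negbTE (hK _ wW)) mulgA xw if_same.
have gluel x y : cylinder K x (glue x y) by move=> k kK; rewrite /glue kK.
have gluer x y : cylinder L y (translate g (glue x y)).
  move=> k kL; rewrite /translate /glue mulVKg kL ifN//.
  apply/negP => gkK; have := gD k (g^-1 * k)%g 1%g 1%g (LD _ kL) (KD _ gkK) D1 D1.
  by rewrite invgM invgK invg1 !mulg1 mulgA mulgV mul1g eqxx.
have [Xu1 Xu2] := UX _ Uu; have [Xv1 Xv2] := VX _ Vv.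
pose y : config G A * config G A := (glue u.1 v.1, glue u.2 v.2).
exists g, (diag_translate g y); split.
  by exists y => //; apply: KU; [exact: Xglue|exact: Xglue|exact: gluel|exact: gluel].
apply: LV; [| |exact: gluer|exact: gluer];
  by apply: hitting_is_shift.2; exact: Xglue.
Qed.

End Topology.

(** * Entropy along Følner sequences *)

Lemma card_patterns (G : groupType) (A : finType) (F : {fset G}) (X : set (config G A)) :
  #|` fset_set (patterns F X)| = nwords (X : set (G -> A)) (enum_fset F).
Proof.
have patP p : p \in enum_fset (fset_set (patterns F X)) <->
    exists2 x, X x & restriction F x = p.
  rewrite -[p \in _]/(p \in fset_set (patterns F X)) in_fset_set; last exact: finite_finset.
  by split=> [/set_mem//|?]; exact/mem_set.
rewrite /nwords -(size_map (fun p : {ffun F -> A} => codom p)).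
apply: perm_size; apply: uniq_perm (uniq_words _ _) _ => [|u].
  rewrite map_inj_uniq ?fset_uniq// => p q pq; apply/ffunP => k.
  move: pq => /eq_in_map; apply; exact: mem_enum.
have codomE x : codom (restriction F x) = map x (enum_fset F).
  rewrite enum_fsetE -map_comp; apply: eq_codom => k /=; exact: ffunE.
apply/idP/idP => [/mapP[p /patP[x Xx <-] ->]|/mem_words[x Xx <-]].
  by apply/mem_words; exists x.
by apply/mapP; exists (restriction F x); [apply/patP; exists x|rewrite codomE].
Qed.

Section Folner.
Context (R : realType) {G : groupType} (S : {fset G}).
Context (S_generates : generates S).

(** Generation provides a word for [g], hence a shortest one, so [get] does not return its
    default. *)
Lemma word_lengthP g : is_word_length S g (word_length S g).
Proof.
apply: getPex.
have [w Sw wg] := S_generates g.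
have ex : exists n, `[< exists w, [/\ is_word S w, size w = n & word_eval w = g] >].
  by exists (size w); apply/asboolP; exists w.
exists (ex_minn ex); case: ex_minnP => n /asboolP nP n_min; split=> // u Su ug.
by apply: n_min; apply/asboolP; exists u.
Qed.

Lemma mem_word_ball_self g r : (word_length S g <= r)%N -> word_ball S r g.
Proof. by rewrite /word_ball/= /word_dist invg1 mul1g. Qed.

Lemma word_ball1 r : word_ball S r 1%g.
Proof.
apply: mem_word_ball_self; have [_ /(_ [::])] := word_lengthP 1%g.
by rewrite /word_eval big_nil => /(_ isT erefl) /leq_trans; apply.
Qed.

Lemma finite_word_ball r : finite_set (word_ball S r).
Proof.
pose T := enum_fset S ++ [seq s^-1%g | s <- enum_fset S].
pose prods := fix prods n := if n is m.+1
  then 1%g :: [seq (s * p)%g | s <- T, p <- prods m] else [:: 1%g].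
apply: sub_finite_set (finite_seq (prods r)) => g.
rewrite /word_ball/= /word_dist invg1 mul1g.
have [[w [Sw <- <-]] _] := word_lengthP g.
elim: r w Sw {g} => [|r IHr] [|s w]//=; rewrite /word_eval ?big_nil ?mem_head//.
move=> /andP[Ss Sw] wr; rewrite big_cons inE; apply/orP; right.
apply: allpairs_f; last exact: IHr.
rewrite mem_cat; case/orP: Ss => [->//|sS]; apply/orP; right.
by apply/mapP; exists s^-1%g; rewrite ?invgK.
Qed.

(** The boundary lies in [F] times the inverses of the ball. Finiteness matters because [fset_set]
    sends infinite sets to the empty set. *)
Lemma finite_boundary r (F : {fset G}) : finite_set (boundary S r F).
Proof.
apply: (@sub_finite_set _ _ [set (f * b^-1)%g | f in [set` F] & b in word_ball S r]).
  move=> g [[_ [[b rb <-] gbF]] _]; exists (g * b)%g => //; exists b => //.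
  by rewrite mulgK.
by apply: finite_image2 => //; exact: finite_word_ball.
Qed.

Lemma folner_covering (A : finType) (a0 : A) (X : set (config G A)) (K : {fset G}) :
  X !=set0 -> (forall g x, X x -> X (translate g x)) -> K != fset0 ->
  exists r, forall F : {fset G},
    (nwords (X : set (G -> A)) (enum_fset F) ^ #|` K| <=
     nwords (X : set (G -> A)) (enum_fset K)
       ^ (#|` F| + #|` fset_set (boundary S r F)|))%N.
Proof.
move=> X0 Xinv K0; set N := nwords _.
exists (\max_(k <- enum_fset K) word_length S k)%N => F; set r := (\max_(k <- _) _)%N.
have Kr k : k \in K -> word_ball S r k.
  by move=> kK; apply: mem_word_ball_self; rewrite /r (big_rem k)//= leq_maxl.
pose T := (F `|` fset_set (boundary S r F))%fset.
(* If t = v k^-1 is outside [F], it is a boundary point: t k is in [F], t is not, and both lie in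
   the ball around t. *)
have TP v k : v \in F -> k \in K -> (v * k^-1)%g \in T.
  move=> vF kK; rewrite in_fsetU in_fset_set; last exact: finite_boundary.
  have [//|gF] := boolP ((v * k^-1)%g \in F); apply/mem_set; split.
    exists v; split=> //; exists k; first exact: Kr.
    by rewrite mulgVK.
  exists (v * k^-1)%g; split; last exact/negP.
  by exists 1%g; [exact: word_ball1|rewrite mulg1].
have K_cover v : v \in enum_fset F ->
    #|[pred i : T | v \in [pred u | ((val i)^-1 * u)%g \in K]]| = #|` K|.
  move=> vF; rewrite cardE -(size_map val) -[RHS](size_map (fun k => (v * k^-1)%g)).
  apply/perm_size/uniq_perm.
  - by rewrite map_inj_uniq ?enum_uniq//; exact: val_inj.
  - rewrite map_inj_uniq ?fset_uniq// => k l /mulgI; exact: invg_inj.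
  move=> g; apply/mapP/mapP => [[i]|[k kK ->]].
    rewrite mem_enum inE => /= iK ->; exists ((val i)^-1 * v)%g => //.
    by rewrite invgM invgK mulgA mulgV mul1g.
  by exists [` TP v k vF kK]%fset => //; rewrite mem_enum !inE /= invgM invgK mulgVK.
pose C (i : T) := [pred u | ((val i)^-1 * u)%g \in K].
have K_gt0 : (0 < #|` K|)%N by rewrite cardfs_gt0.
apply: leq_trans (@shearer R _ _ T (X : set (G -> A)) _ C _ K_gt0 K_cover) _.
have NK : (0 < N (enum_fset K))%N by exact/nwords_gt0.
apply: (@leq_trans (N (enum_fset K) ^ #|{: T}|)%N).
  rewrite -prod_nat_const; apply: leq_prod => i _.
  apply: (@leq_trans (N [seq (val i * k)%g | k <- enum_fset K])).
    apply: (nwords_sub a0) => u; rewrite mem_filter => /andP[/= iu _].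
    by apply/mapP; exists ((val i)^-1 * u)%g; rewrite ?mulVKg.
  apply: (@leq_nwords_map _ _ _ _ _ id) => x Xx.
  exists (map (translate (val i)^-1 x) (enum_fset K)).
    by apply/mem_words; exists (translate (val i)^-1%g x) => //; exact: Xinv.
  by rewrite -map_comp; apply: eq_map => k /=; rewrite /translate invgK.
by rewrite -cardfE leq_pexp2l// (leq_card_fsetU _ _).1.
Qed.

(** Writing N for the count and rho for the boundary ratio, the covering gives log N_F / |F| <= (1 +
    rho) log N_K / |K|, where [K] is chosen with log N_K / |K| < c + e / 2. *)
Lemma has_entropy_of_bounds (A : finType) (a0 : A) (X : set (config G A)) (c : R) :
  X !=set0 -> (forall g x, X x -> X (translate g x)) -> 0 <= c ->
  entropy_ge c (X : set (G -> A)) ->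
  (forall eps : R, 0 < eps -> exists K : {fset G},
    (nwords (X : set (G -> A)) (enum_fset K))%:R < expR ((c + eps) * #|` K|%:R)) ->
  has_entropy S X c.
Proof.
move=> X0 Xinv c0 lower upper F [F0 folF]; set N := nwords (X : set (G -> A)) in lower upper *.
have N0 s : (0 < (N s)%:R :> R) by rewrite ltr0n; exact/nwords_gt0.
have F_gt0 n : 0 < #|` F n|%:R :> R by rewrite ltr0n cardfs_gt0.
apply/cvgrPdist_le => e e0.
have e2 : 0 < e / 2 by rewrite divr_gt0.
have ce2 : 0 < c + e / 2 by rewrite ltr_wpDl.
have [K KN] := upper _ e2.
have K0 : K != fset0.
  apply/eqP => K0; move: KN; rewrite K0 cardfs0 mulr0 expR0 ltNge ler1n.
  by rewrite -(ltr0n R) N0.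
have K_gt0 : 0 < #|` K|%:R :> R by rewrite ltr0n cardfs_gt0.
have [r covering] := folner_covering _ a0 X K X0 Xinv K0.
near=> n.
(* This threshold keeps (1 + rho) (c + e / 2) at most c + e. *)
have small : boundary_ratio S R r (F n) <= e / 2 / (c + e / 2).
  by near: n; apply: cvgr_le (folF r) _ _; rewrite divr_gt0.
rewrite card_patterns -/N.
have lb : c <= ln (N (enum_fset (F n)))%:R / #|` F n|%:R.
  by rewrite ler_pdivlMr// -ler_expR lnK ?posrE.
rewrite distrC ger0_norm ?subr_ge0// lerBlDl ler_pdivrMr//.
rewrite -(@ler_pM2l _ #|` K|%:R)//.
rewrite -ler_expR expRM_natl lnK ?posrE// -natrX.
apply: (@le_trans _ _ (N (enum_fset K) ^ (#|` F n| + #|` fset_set (boundary S r (F n))|))%:R).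
  by rewrite ler_nat covering.
rewrite natrX -[X in X ^+ _]lnK ?posrE// -expRM_natl ler_expR.
apply: (@le_trans _ _ ((#|` F n| + #|` fset_set (boundary S r (F n))|)%:R
    * ((c + e / 2) * #|` K|%:R))).
  by rewrite ler_wpM2l// -ler_expR lnK ?posrE// ltW.
rewrite mulrA [leRHS]mulrC ler_wpM2r//.
have -> : (#|` F n| + #|` fset_set (boundary S r (F n))|)%:R
    = (1 + boundary_ratio S R r (F n)) * #|` F n|%:R.
  by rewrite mulrDl mul1r divfK ?gt_eqF// natrD.
rewrite mulrAC ler_wpM2r// mulrDl mul1r -addrA lerD2l.
rewrite [leRHS]splitr lerD2l -ler_pdivlMr//.
Unshelve. all: by end_near.
Qed.

End Folner.

Theorem corollary1p6 (R : realType) (G : groupType) (S : {fset G})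
  (G_countable : countable [set: G]) (G_infinite : infinite_set [set: G])
  (S_generates : generates S) (G_amenable : amenable S R)
  (A : finType) (A_nonempty : (0 < #|A|)%N)
  (c : R) (c_ge0 : 0 <= c) (c_le : c <= ln (#|A|%:R)) :
  exists X : set (config G A),
    [/\ X !=set0, is_shift X, weakly_mixing X & has_entropy S X c].
Proof.
have [a0 _] : exists a : A, a \in A by exact/card_gt0P.
have [Fam [small lower upper]] := exists_hitting_family a0 G_infinite c c_ge0 c_le.
have [shift_closed shift_inv] := hitting_is_shift a0 Fam.
have X0 : hitting_shift a0 Fam !=set0.
  by have := lower fset0; rewrite cardfs0 mulr0 expR0 ler1n => /nwords_gt0.
exists (hitting_shift a0 Fam); split=> //.
  exact: hitting_weakly_mixing.
exact: has_entropy_of_bounds.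
Qed.
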